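(* Let $\mathcal{A}$ be a complex unital $C^*$-algebra and let $a\in\mathcal{A}$ be a non-zero positive element. Let $x\in\mathcal{A}_a$, let $x^{\#_a}$ be an $a$-adjoint of $x$, and let $\phi$ be an Orlicz function. Then $$\phi\big(v_a^2(x)\big)\le \frac12\phi\big(v_a(x^2)\big)+\frac12\phi\left(\frac{\|xx^{\#_a}+x^{\#_a}x\|_a}{2}\right).$$
   Context: A functional $f\in\mathcal{A}^*$ is positive ($f\ge 0$) if $f(x^*x)\ge 0$ for all $x\in\mathcal{A}$. $\mathcal{S}_a(\mathcal{A})=\{f\in\mathcal{A}^*: f\ge0,\ f(a)=1\}$; the $a$-numerical radius is $v_a(x)=\sup\{|f(ax)|: f\in\mathcal{S}_a(\mathcal{A})\}$; and $\|x\|_a=\sup\{\sqrt{f(x^*ax)}: f\in\mathcal{S}_a(\mathcal{A})\}$ (possibly $+\infty$ in general, but finite on $\mathcal{A}_a$). An $a$-adjoint of $x\in\mathcal{A}$ is an element $x^{\#_a}\in\mathcal{A}$ with $ax^{\#_a}=x^*a$ (it need not exist or be unique); $\mathcal{A}_a$ is the set of all elements of $\mathcal{A}$ that have an $a$-adjoint. The notation $v_a^2(x)$ means $(v_a(x))^2$. An Orlicz function is a map $\phi:[0,\infty)\to[0,\infty)$ that is continuous, convex, non-decreasing, with $\phi(0)=0$ and $\phi(u)\to\infty$ as $u\to\infty$; it is always assumed non-degenerate, i.e. $\phi(u)>0$ for $u>0$. *)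

(* Defs.v *)
From HB Require Import structures.
From mathcomp Require Import all_boot all_order all_algebra.
From mathcomp Require Import all_classical all_reals all_analysis.
From mathcomp Require Export complex.

Set Implicit Arguments.
Unset Strict Implicit.
Unset Printing Implicit Defensive.

Import Order.TTheory GRing.Theory Num.Theory.
Import numFieldNormedType.Exports.

Local Open Scope classical_set_scope.
Local Open Scope ring_scope.

(* The norm of a normed module over R[i] is R[i]-valued, with nonnegative real
   values: on R[i], [0 <= z] means that z is real and nonnegative.
   The product is part of the mixin because Hierarchy Builder refuses a
   structure that joins rings and normed modules (Num.NumDomain would need to
   inherit from it); the algebra structure is declared after the structure. *)
HB.mixin Record isCStarAlgebra (R : realType) A
    & CompleteNormedModule R[i] A := {
  cstar_one : A;
  cstar_mul : A -> A -> A;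
  cstar_mulA : associative cstar_mul;
  cstar_mul1r : left_id cstar_one cstar_mul;
  cstar_mulr1 : right_id cstar_one cstar_mul;
  cstar_mulDl : left_distributive cstar_mul +%R;
  cstar_mulDr : right_distributive cstar_mul +%R;
  cstar_oner_neq0 : cstar_one != 0;
  cstar_scalerAl : forall (l : R[i]) (x y : A),
    l *: cstar_mul x y = cstar_mul (l *: x) y;
  cstar_scalerAr : forall (l : R[i]) (x y : A),
    l *: cstar_mul x y = cstar_mul x (l *: y);
  star : A -> A;
  starK : involutive star;
  starD : {morph star : x y / x + y};
  starZ : forall (l : R[i]) (x : A), star (l *: x) = (l^*)%C *: star x;
  starM : forall x y : A, star (cstar_mul x y) = cstar_mul (star y) (star x);
  cstar_ler_normM : forall x y : A, `|cstar_mul x y| <= `|x| * `|y|;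
  cstar_normr_starM : forall x : A, `|cstar_mul (star x) x| = `|x| ^+ 2
}.

#[short(type="cstarAlgType")]
HB.structure Definition CStarAlgebra (R : realType) :=
  {A of isCStarAlgebra R A & CompleteNormedModule R[i] A}.

#[non_forgetful_inheritance]
HB.instance Definition _ (R : realType) (A : cstarAlgType R) :=
  GRing.Zmodule_isNzRing.Build (CStarAlgebra.sort A) (@cstar_mulA R A)
    (@cstar_mul1r R A) (@cstar_mulr1 R A) (@cstar_mulDl R A) (@cstar_mulDr R A)
    (@cstar_oner_neq0 R A).

#[non_forgetful_inheritance]
HB.instance Definition _ (R : realType) (A : cstarAlgType R) :=
  GRing.Lmodule_isLalgebra.Build R[i] (CStarAlgebra.sort A)
    (@cstar_scalerAl R A).

#[non_forgetful_inheritance]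
HB.instance Definition _ (R : realType) (A : cstarAlgType R) :=
  GRing.Lalgebra_isAlgebra.Build R[i] (CStarAlgebra.sort A)
    (@cstar_scalerAr R A).

Section CStarAlgebraDefs.
Context {R : realType} {A : cstarAlgType R}.
Implicit Types (a x y : A) (f : {linear A -> R[i]^o}).

Definition invertible x := exists y, y * x = 1 /\ x * y = 1.

Definition spectrum x : set R[i] := [set l | ~ invertible (x - l%:A)].

Definition positive_element a :=
  star a = a /\ spectrum a `<=` [set l | 0 <= l].

Definition positive_functional f := forall x, 0 <= f (star x * x).

Definition a_states a : set {linear A -> R[i]^o} :=
  [set f : {linear A -> R[i]^o} | [/\ continuous f, positive_functional f & f a = 1]].

(* [num_radius a] and [a_norm a] may take the value +oo in general; they are
   finite on a-adjointable elements, where [fine] gives their real value. *)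
Definition num_radius a x : \bar R :=
  ereal_sup [set (Normc.normc (f (a * x)))%:E | f in a_states a].

(* [f (star x * a * x)] is real and nonnegative when [a] is positive. *)
Definition a_norm a x : \bar R :=
  ereal_sup [set (Num.sqrt (complex.Re (f (star x * a * x))))%:E
            | f in a_states a].

Definition a_adjoint a x y := a * y = star x * a.

Definition a_adjointable a : set A := [set x | exists y, a_adjoint a x y].

End CStarAlgebraDefs.

(* A map [0, +oo[ -> [0, +oo[ is represented by a function on R of which only
   the values on [0, +oo[ matter. *)
Definition orlicz_function (R : realType) (phi : R -> R) :=
  let D := [set` `[0%R, +oo[] : set R in
  [/\ (forall u, D u -> 0 <= phi u),
      {within D, continuous phi},
      @convex_function R R^o D phi,
      (forall u v, D u -> u <= v -> phi u <= phi v) &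
      [/\ phi 0 = 0,
          phi u @[u --> +oo] --> +oo &
          forall u, 0 < u -> 0 < phi u]].

(* Main.v *)
(* For a state [f] of [S_a], [<u, w> := f (w^* a u)] is a positive semidefinite
   sesquilinear form with [<1, 1> = 1], for which [x] and [x^#] are adjoint.
   Buzano's inequality for the vectors [x], [x^#] and [1] gives
     [2 |f (a x)|^2 <= |f (a x^2)| + f (a T) / 2],  [T := x x^# + x^# x],
   and [f (a T) = <T, 1> <= sqrt (f (T^* a T))] by Cauchy-Schwarz; monotonicity
   and convexity of [phi] conclude.
   Semidefiniteness of the form does not require a square root of [a]: for every
   [u], the function [t |-> f (u^* (a + t)^-1 u)] is nonincreasing on [t > 0] and
   tends to 0 at infinity, hence is nonnegative.
   The suprema are finite, so that [fine] does not hide an infinite value: [T] is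
   self-adjoint for the form, which bounds [f (T^* a T)] independently of [f]. *)
Require Import Defs.
From mathcomp Require Import all_boot all_order all_algebra.
From mathcomp Require Import all_classical all_reals all_analysis.
From mathcomp Require Import ring lra.

Import Order.TTheory GRing.Theory Num.Theory.
Import numFieldNormedType.Exports.

Local Open Scope ring_scope.

Set Implicit Arguments.
Unset Strict Implicit.

(** * Positive semidefinite sesquilinear forms *)

Section PsdForm.
Variables (C : numClosedFieldType) (V : lmodType C) (B : V -> V -> C).
Hypothesis Bl : forall l u u' w, B (l *: u + u') w = l * B u w + B u' w.
Hypothesis Br : forall l u w w', B u (l *: w + w') = l^* * B u w + B u w'.
Hypothesis B_ge0 : forall u, 0 <= B u u.

Lemma psd_formZD l u w :
  B (l *: w + u) (l *: w + u) =
  l * l^* * B w w + l * B w u + l^* * B u w + B u u.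
Proof. by rewrite Bl !Br; ring. Qed.

(** As [B] is real on the diagonal, [l * B w u + l^* * B u w] is real for every [l]; [l = 1] and
    [l = 'i] determine [B w u]. *)
Lemma psd_form_conj u w : B w u = (B u w)^*.
Proof.
have cross l : l * B w u + l^* * B u w \is Num.real.
  have : l * B w u + l^* * B u w =
      B (l *: w + u) (l *: w + u) - `|l| ^+ 2 * B w w - B u u.
    by rewrite psd_formZD normCK; ring.
  by move=> ->; rewrite !realB ?realM ?realX ?ger0_real.
have := cross 1; have := cross 'i.
rewrite !CrealE conjCi conjC1 !rmorphD !rmorphM /= rmorphN /= conjCi conjC1.
rewrite !mul1r => /eqP Ei /eqP E1.
have two0 : 2 != 0 :> C by rewrite pnatr_eq0.
apply: (mulfI two0).
have ii : 'i * 'i = -1 :> C by rewrite -expr2 sqrCi.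
transitivity (B w u + B u w - 'i * ('i * B w u - 'i * B u w)).
  by rewrite mulrBr !mulrA ii; ring.
have -> : 'i * B w u - 'i * B u w = 'i * B w u + - 'i * B u w by rewrite mulNr.
rewrite -Ei -E1 opprK mulrDr !mulrA mulrN ii; ring.
Qed.

Lemma psd_form_CauchySchwarz u w : `|B u w| ^+ 2 <= B u u * B w w.
Proof.
have quad (t : C) : t \is Num.real ->
    0 <= t ^+ 2 * `|B u w| ^+ 2 * B w w - t * `|B u w| ^+ 2 *+ 2 + B u u.
  move=> /CrealP tR; have := B_ge0 ((- t * B u w) *: w + u).
  rewrite psd_formZD [B w u]psd_form_conj rmorphM rmorphN /= tR normCK.
  by congr (0 <= _); ring.
have [Bw0|Bw_neq0] := eqVneq (B w w) 0.
  rewrite Bw0 mulr0; case: (eqVneq (B u w) 0) => [->|b0].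
    by rewrite normr0 expr0n.
  have b2 : `|B u w| ^+ 2 != 0 by rewrite expf_neq0 ?normr_eq0.
  (* With [B w w = 0] the quadratic is affine in [t]; this [t] gives it the negative value
     [- (B u u + 2)]. *)
  have := quad ((B u u + 1) / `|B u w| ^+ 2).
  rewrite Bw0 mulr0 divfK // add0r => /(_ _) q; exfalso.
  have : 0 <= - (B u u + 2).
    have -> : - (B u u + 2) = - ((B u u + 1) *+ 2) + B u u by ring.
    by apply: q; rewrite realM ?realD ?realV ?realX ?ger0_real ?normr_ge0 ?real1.
  by rewrite oppr_ge0 lt_geF // ltr_wpDl.
have Bw_gt0 : 0 < B w w by rewrite lt_def Bw_neq0 B_ge0.
(* The quadratic is minimal at this [t]. *)
have := quad (B w w)^-1; rewrite realV ger0_real // => /(_ isT) q.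
rewrite -subr_ge0; have := mulr_ge0 q (ltW Bw_gt0); congr (0 <= _).
by field.
Qed.

(* Buzano's inequality: the vector [v] below is the image of [u] under the
   reflection fixing [e], so [B v v = B u u], while
   [B v w + B u w = 2 B u e B e w]. *)
Lemma psd_form_Buzano u w e : B e e = 1 ->
  `|B u e * B e w| *+ 2 <= `|B u w| + (B u u + B w w) / 2.
Proof.
move=> Be; pose v := (- (B u e *+ 2)) *: e + u.
have Bv : B v v = B u u.
  rewrite psd_formZD Be (psd_form_conj u e) rmorphN rmorphMn /=.
  by ring.
have -> : `|B u e * B e w| *+ 2 = `|B u w - B v w|.
  rewrite -normrMn; congr `|_|; rewrite /v Bl; ring.
apply: (le_trans (ler_normB _ _)); rewrite lerD2l.
rewrite -ler_sqr ?nnegrE ?divr_ge0 ?addr_ge0 ?normr_ge0 //.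
apply: (le_trans (psd_form_CauchySchwarz v w)); rewrite Bv -subr_ge0.
have -> : ((B u u + B w w) / 2) ^+ 2 - B u u * B w w =
    ((B u u - B w w) / 2) ^+ 2 by field.
by rewrite real_exprn_even_ge0 // realM ?realB ?ger0_real.
Qed.
End PsdForm.

(** * Real analysis: a monotonicity test and a growth bound *)

Section Calculus.
Variable R : realType.

(** The remainder estimate makes [d t] the derivative of [q] at [t], whose sign then decides. *)
Lemma nonincreasing_quadratic_remainder (q d : R -> R) :
  (forall t : R, 0 < t -> exists K e : R, 0 < e /\
    forall s : R, `|s - t| < e ->
      `|q s - q t - d t * (s - t)| <= K * (s - t) ^+ 2) ->
  (forall t : R, 0 < t -> d t <= 0) ->
  forall s t : R, 0 < s -> s <= t -> q t <= q s.
Proof.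
move=> qd d_le0.
have dq (t : R) : 0 < t -> is_derive t 1 q (d t).
  move=> t_gt0; apply/is_derive1_caratheodory.
  exists (fun z => if z == t then d t else (q z - q t) / (z - t)).
  split=> [z||]; rewrite ?eqxx //.
    case: eqVneq => [->|zt]; first by rewrite !subrr mulr0.
    by rewrite divfK // subr_eq0.
  have [K [e [e_gt0 He]]] := qd _ t_gt0.
  apply/cvgrPdist_le => eps eps_gt0; rewrite eqxx.
  have K_gt0 : 0 < `|K| + 1 by rewrite ltr_wpDl.
  have m_gt0 : 0 < Num.min e (eps / (`|K| + 1)).
    by rewrite lt_min e_gt0 divr_gt0.
  near=> z; case: eqVneq => [_|zt]; first by rewrite subrr normr0 ltW.
  have zt0 : z - t != 0 by rewrite subr_eq0.
  have : `|z - t| < Num.min e (eps / (`|K| + 1)).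
    by rewrite distrC; near: z; exact: cvgr_dist_lt.
  rewrite lt_min => /andP[/He zK].
  rewrite ltr_pdivlMr // => ze.
  rewrite -(ler_pM2r (_ : 0 < `|z - t|)) ?normr_gt0 //.
  rewrite -normrM mulrBl divfK // distrC (le_trans zK) //.
  rewrite -real_normK ?num_real // expr2 mulrA ler_wpM2r //.
  rewrite (le_trans _ (ltW ze)) // mulrC ler_wpM2l //.
  by rewrite (le_trans (ler_norm _)) // lerDl.
move=> s t s_gt0 st.
have pos (x : R) : x \in `]s, t[%R -> 0 < x.
  by rewrite in_itv /= => /andP[/(lt_trans s_gt0)].
apply: (@ler0_derive1_le_cc _ q s t).
- by move=> x /pos /dq [].
- by move=> x /pos x_gt0; rewrite derive1E; have [_ ->] := dq _ x_gt0; exact: d_le0.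
- apply: derivable_within_continuous => x; rewrite in_itv /= => /andP[sx _].
  by have [] := dq _ (lt_le_trans s_gt0 sx).
- by rewrite in_itv /= st lexx.
- by rewrite in_itv /= st lexx.
- exact: st.
Unshelve. all: by end_near. Qed.

(** Repeated squaring gives [r 0 ^ (2 ^ k) <= r k <= c m ^ (2 ^ k)], so [(r 0 / m) ^ (2 ^ k)] stays
    below [c]; by Bernoulli's inequality this excludes [r 0 > m]. *)
Lemma doubly_exponential_bound (r : nat -> R) (c m : R) :
  0 < m -> 0 <= r 0%N -> (forall k, r k ^+ 2 <= r k.+1) ->
  (forall k, r k <= c * m ^+ (2 ^ k)) -> r 0%N <= m.
Proof.
move=> m_gt0 r0 rS rc; rewrite leNgt; apply/negP => mr.
have r_pow k : r 0%N ^+ (2 ^ k) <= r k.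
  elim: k => [|k IH]; first by rewrite expn0 expr1.
  rewrite expnSr exprM (le_trans _ (rS k)) // lerXn2r ?nnegrE ?exprn_ge0 //.
  by rewrite (le_trans _ IH) // exprn_ge0.
have z_gt0 : 0 < r 0%N / m - 1 by rewrite subr_gt0 ltr_pdivlMr // mul1r.
have bern n : 1 + n%:R * (r 0%N / m - 1) <= (r 0%N / m) ^+ n.
  elim: n => [|n IH]; first by rewrite mul0r addr0 expr0.
  rewrite exprS; apply: le_trans (ler_wpM2l _ IH); last by rewrite divr_ge0 // ltW.
  have : 0 <= n%:R * (r 0%N / m - 1) ^+ 2 by rewrite mulr_ge0 ?sqr_ge0.
  rewrite -natr1; set y := r 0%N / m; set N := n%:R; nra.
have c_ge k : (r 0%N / m) ^+ (2 ^ k) <= c.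
  rewrite expr_div_n ler_pdivrMr ?exprn_gt0 //.
  exact: le_trans (r_pow k) (rc k).
have c_ge0 : 0 <= c by rewrite (le_trans _ (c_ge 0%N)) // divr_ge0 // ltW.
pose n := Num.bound (c / (r 0%N / m - 1)).
have cn : c < n%:R * (r 0%N / m - 1).
  by rewrite -ltr_pdivrMr // archi_boundP // divr_ge0 // ltW.
have : (2 ^ n)%:R * (r 0%N / m - 1) < n%:R * (r 0%N / m - 1).
  rewrite (le_lt_trans _ cn) // (le_trans _ (c_ge n)) //.
  by rewrite (le_trans _ (bern _)) // lerDr.
by rewrite ltr_pM2r // ltr_nat ltnNge ltnW // ltn_expl.
Qed.
End Calculus.

(** * Positive functionals and the resolvent of a positive element *)

Section Positivity.
Variables (R : realType) (A : cstarAlgType R) (f : {linear A -> R[i]^o}).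
Implicit Types (a u w x y : A) (t : R).

Definition weighted_form a u w : R[i] := f (star w * a * u).

Lemma weighted_form_linearl a l u u' w :
  weighted_form a (l *: u + u') w =
  l * weighted_form a u w + weighted_form a u' w.
Proof. by rewrite /weighted_form mulrDr -scalerAr linearP. Qed.

Lemma weighted_form_linearr a l u w w' :
  weighted_form a u (l *: w + w') =
  l^* * weighted_form a u w + weighted_form a u w'.
Proof.
by rewrite /weighted_form starD starZ !mulrDl -!scalerAl linearP.
Qed.

(* The mixin fields mention [cstar_mul], which rewriting does not identify with
   the ring multiplication. *)
Lemma star_mulr x y : star (x * y) = star y * star x.
Proof. exact: starM. Qed.

Lemma cstar_normM_le x y : `|x * y| <= `|x| * `|y|.
Proof. exact: cstar_ler_normM. Qed.

Lemma star1 : star (1 : A) = 1.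
Proof. by rewrite -[LHS]mulr1 -{2}[1]starK -star_mulr mulr1 starK. Qed.

Lemma star_realZ1 t : star (t%:C%C%:A : A) = t%:C%C%:A.
Proof. by rewrite starZ conjc_real star1. Qed.

Hypotheses (f_cont : continuous f) (f_pos : positive_functional f).

Lemma functional_bound :
  exists2 K : R, 0 < K & forall y, `|f y| <= K%:C%C * `|y|.
Proof.
have /linear_bounded_continuous/linear_boundedP[M [Mreal HM]] := f_cont.
have /complex_realP[k kM] := Mreal.
exists (`|k| + 1); first by rewrite ltr_wpDl.
move=> y; apply: HM; rewrite kM ltcR.
by rewrite (le_lt_trans (ler_norm _)) // ltrDl.
Qed.

(** A positive functional makes the form with weight 1 Hermitian; this is applied to [u] and
    [x * u]. *)
Lemma functional_conj x u : star x = x ->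
  (f (star u * x * u))^* = f (star u * x * u).
Proof.
move=> xs.
have pos1 z : 0 <= weighted_form 1 z z.
  by rewrite /weighted_form mulr1; exact: f_pos.
have := @psd_form_conj _ _ (weighted_form 1)
  (weighted_form_linearl 1) (weighted_form_linearr 1) pos1
  u (x * u).
by rewrite /weighted_form !mulr1 star_mulr xs mulrA => /esym.
Qed.

(** The norm takes values in [R[i]]; its real part allows estimates in the ordered field [R]. *)
Definition rnorm y : R := complex.Re `|y|.

Lemma rnormE y : `|y| = (rnorm y)%:C%C.
Proof. by rewrite /rnorm RRe_real // ger0_real. Qed.

Lemma rnorm_ge0 y : 0 <= rnorm y.
Proof. by rewrite -ler0c -rnormE. Qed.

Lemma rnormM x y : rnorm (x * y) <= rnorm x * rnorm y.
Proof.
by rewrite -lecR rmorphM /= -!rnormE; exact: cstar_normM_le.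
Qed.

Lemma rnormD x y : rnorm (x + y) <= rnorm x + rnorm y.
Proof. by rewrite -lecR rmorphD /= -!rnormE; exact: ler_normD. Qed.

Lemma rnormN x : rnorm (- x) = rnorm x.
Proof. by rewrite /rnorm normrN. Qed.

Lemma rnormZ t x : rnorm (t%:C%C *: x) = `|t| * rnorm x.
Proof.
apply: complexI; rewrite rmorphM /= -!rnormE normrZ normc_def /=.
by rewrite expr0n addr0 sqrtr_sqr.
Qed.

Lemma rnormX x n : rnorm (x ^+ n.+1) <= rnorm x ^+ n.+1.
Proof.
elim: n => [//|n IH]; rewrite exprS [leRHS]exprS.
by rewrite (le_trans (rnormM _ _)) // ler_wpM2l // rnorm_ge0.
Qed.

Lemma Re_functional_bound :
  exists2 K : R, 0 < K & forall y, `|complex.Re (f y)| <= K * rnorm y.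
Proof.
have [K K_gt0 HK] := functional_bound.
exists K => // y; rewrite -lecR rmorphM /= -rnormE.
exact: le_trans (normc_ge_Re _) (HK y).
Qed.

Section Resolvent.
Variables (a : A) (r : R -> A).
Hypothesis a_star : star a = a.
Hypothesis rl : forall t, 0 < t -> r t * (a + t%:C%C%:A) = 1.
Hypothesis rr : forall t, 0 < t -> (a + t%:C%C%:A) * r t = 1.

Lemma star_resolvent t : 0 < t -> star (r t) = r t.
Proof.
move=> t0; rewrite -[LHS]mulr1 -(rr t0) mulrA.
have -> : a + t%:C%C%:A = star (a + t%:C%C%:A) by rewrite starD a_star star_realZ1.
by rewrite -star_mulr rr // star1 mul1r.
Qed.

Lemma resolvent_identity s t : 0 < s -> 0 < t ->
  r s - r t = (t - s)%:C%C *: (r s * r t).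
Proof.
move=> s0 t0.
have -> : r s - r t = r s * ((a + t%:C%C%:A) - (a + s%:C%C%:A)) * r t.
  by rewrite mulrBr mulrBl -mulrA rr // mulr1 rl // mul1r.
rewrite opprD addrACA subrr add0r -scalerBl -rmorphB /=.
by rewrite -scalerAr mulr1 -scalerAl.
Qed.

(** By the resolvent identity, [|r s - r t| <= |s - t| |r s| |r t| <= |r s| / 2], which is absorbed
    on the left. *)
Lemma resolvent_local_bound s t : 0 < s -> 0 < t ->
  `|s - t| * rnorm (r t) <= 1 / 2 -> rnorm (r s) <= 2 * rnorm (r t).
Proof.
move=> s0 t0 st.
have : rnorm (r s) <= rnorm (r t) + rnorm (r s - r t).
  by rewrite -{1}(subrKC (r t) (r s)) rnormD.
rewrite resolvent_identity // rnormZ distrC.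
have := ler_wpM2l (normr_ge0 (s - t)) (rnormM (r s) (r t)).
have := ler_wpM2l (rnorm_ge0 (r s)) st.
lra.
Qed.

Variable u : A.
Let G y := complex.Re (f (star u * y * u)).
Let q t := G (r t).
(** Derivative of [q], because the resolvent has derivative [- r t ^ 2]. *)
Let d t := - G (r t * r t).

Let GB x y : G (x - y) = G x - G y.
Proof. by rewrite /G mulrBr mulrBl linearB raddfB. Qed.

Let GZ t y : G (t%:C%C *: y) = t * G y.
Proof.
rewrite /G -scalerAr -scalerAl linearZ /=.
by case: (f _) => x1 x2 /=; rewrite mul0r subr0.
Qed.

(* [q' = - f (u^* r^2 u) <= 0] because [r t] is self-adjoint, and [q] vanishes at
   infinity. *)
Lemma resolvent_functional_ge0 : forall t, 0 < t -> 0 <= q t.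
Proof.
have [K0 K0_gt0 HK0] := Re_functional_bound.
pose K := K0 * (rnorm (star u) * rnorm u).
have K_ge0 : 0 <= K by rewrite mulr_ge0 ?mulr_ge0 ?rnorm_ge0 // ltW.
have HK y : `|G y| <= K * rnorm y.
  apply: (le_trans (HK0 _)); rewrite /K -[leRHS]mulrA ler_wpM2l ?(ltW K0_gt0) //.
  apply: (le_trans (rnormM _ _)); rewrite [leRHS]mulrAC.
  by rewrite ler_wpM2r ?rnorm_ge0 // rnormM.
have q_nincr : forall s t : R, 0 < s -> s <= t -> q t <= q s.
  apply: (@nonincreasing_quadratic_remainder _ q d) => t t_gt0; last first.
    rewrite /d oppr_le0 /G mulrA -(mulrA (star u * _)) -{1}(star_resolvent t_gt0).
    by rewrite -star_mulr; have := f_pos (r t * u); rewrite lecE => /andP[].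
  have N1 : 0 < 2 * (rnorm (r t) + 1) by rewrite mulr_gt0 ?ltr_wpDl ?rnorm_ge0.
  (* The remainder computed below contains [r s], whose norm is at most [2 |r t|] this close to [t];
     the radius [t] keeps [s] positive. *)
  exists (K * (2 * rnorm (r t)) * rnorm (r t) ^+ 2).
  exists (Num.min t (1 / (2 * (rnorm (r t) + 1)))).
  split=> [|s]; first by rewrite lt_min t_gt0 divr_gt0.
  rewrite lt_min => /andP[st1 st2].
  have s_gt0 : 0 < s by move: st1; rewrite distrC ltr_norml; lra.
  have rs : rnorm (r s) <= 2 * rnorm (r t).
    apply: resolvent_local_bound => //.
    move: st2; rewrite ltr_pdivlMr //.
    have := normr_ge0 (s - t); have := rnorm_ge0 (r t); nra.
  (* Two uses of the resolvent identity extract the factor [(s - t) ^ 2]. *)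
  have -> : q s - q t - d t * (s - t) = 
      G (((s - t) ^+ 2)%:C%C *: (r s * r t * r t)).
    rewrite -GB resolvent_identity // GZ.
    have -> : (s - t) ^+ 2 = (t - s) * (t - s) by ring.
    rewrite rmorphM /= -scalerA GZ scalerAl -resolvent_identity //.
    by rewrite [(r s - _) * _]mulrBl GB /d; ring.
  rewrite (le_trans (HK _)) // rnormZ ger0_norm ?sqr_ge0 //.
  have rst : rnorm (r s * r t * r t) <= 2 * rnorm (r t) * rnorm (r t) ^+ 2.
    rewrite (le_trans (rnormM _ _)) // expr2 mulrA ler_wpM2r ?rnorm_ge0 //.
    by rewrite (le_trans (rnormM _ _)) // ler_wpM2r ?rnorm_ge0.
  have := ler_wpM2l K_ge0 (ler_wpM2l (sqr_ge0 (s - t)) rst).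
  by congr (_ <= _); ring.
move=> t t_gt0; rewrite leNgt; apply/negP => qt_lt0.
(* Since [s r s = 1 - a r s], the resolvent decays like [1 / s]. *)
have r_le s : 0 < s -> s * rnorm (r s) <= rnorm 1 + rnorm a * rnorm (r s).
  move=> s_gt0; have : rnorm (a * r s) <= rnorm a * rnorm (r s) := rnormM _ _.
  have : rnorm (s%:C%C *: r s) <= rnorm 1 + rnorm (a * r s).
    have -> : s%:C%C *: r s = 1 - a * r s.
      by rewrite -(rr s_gt0) mulrDl -scalerAl mul1r addrC addKr.
    by rewrite -[rnorm (a * _)]rnormN rnormD.
  by rewrite rnormZ gtr0_norm //; lra.
have nq_gt0 : 0 < - q t by rewrite oppr_gt0.
(* At [s = t + |a| + w] the decay gives [w |r s| <= |1|], while [- q t <= - q s <= K |r s|]; for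
   this [w] the two contradict [q t < 0]. *)
pose w := K * (rnorm 1 + 1) / (- q t).
have one_ge0 := rnorm_ge0 1; have a_ge0 := rnorm_ge0 a.
have w_ge0 : 0 <= w.
  by apply: divr_ge0; [rewrite mulr_ge0 // addr_ge0 | exact: ltW].
have wq : w * - q t = K * (rnorm 1 + 1) by rewrite divfK // gt_eqF.
have t_le_s : t <= t + rnorm a + w by lra.
have s_gt0 := lt_le_trans t_gt0 t_le_s.
have := q_nincr _ _ t_gt0 t_le_s; have := r_le _ s_gt0.
have := HK (r (t + rnorm a + w)); rewrite ler_norml => /andP[+ _].
rewrite -/(q _) => qs_ge rs_le q_le.
have rs_ge0 := rnorm_ge0 (r (t + rnorm a + w)).
set N := rnorm (r _) in qs_ge rs_le rs_ge0.
have wN : w * N <= rnorm 1 by nra.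
have qN : - q t <= K * N by lra.
have := ler_wpM2r (_ : 0 <= rnorm 1 + 1) qN.
have := ler_wpM2r (_ : 0 <= - q t) wN.
have -> : w * N * - q t = K * N * (rnorm 1 + 1) by rewrite mulrAC wq; ring.
by move=> /(_ ltac:(lra)) + /(_ ltac:(lra)); nra.
Qed.

End Resolvent.
End Positivity.

(* Since [a + t = (a + t) (a + t)^-1 (a + t)], positivity of the resolvent at
   [(a + t) u] gives [0 <= f (u^* (a + t) u)]; then [t] tends to 0. *)
Lemma positive_element_form_ge0 (R : realType) (A : cstarAlgType R)
    (f : {linear A -> R[i]^o}) (a u : A) :
  continuous f -> positive_functional f -> positive_element a ->
  0 <= weighted_form f a u u.
Proof.
move=> f_cont f_pos [a_star a_spec].
have inv (t : R) : exists y, 0 < t ->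
    y * (a + t%:C%C%:A) = 1 /\ (a + t%:C%C%:A) * y = 1.
  (* The value 0 for [t <= 0] is a filler that makes the choice of [r] total. *)
  case: (ltP 0 t) => [t_gt0|_]; last by exists 0.
  have /contrapT[y [yl yr]] : ~ spectrum a (- t)%:C%C.
    move=> /a_spec /=; rewrite ler0c oppr_ge0 => /(lt_le_trans t_gt0).
    by rewrite ltxx.
  by exists y => _; move: yl yr; rewrite rmorphN /= scaleNr opprK.
have /choice[r rP] := inv.
have Re_ge0 : 0 <= complex.Re (f (star u * a * u)).
  have shifted (t : R) : 0 < t -> 0 <= complex.Re (f (star u * a * u)) +
      t * complex.Re (f (star u * u)).
    move=> t_gt0; have [rl rr] := rP _ t_gt0.
    have := resolvent_functional_ge0 f_cont f_pos a_star
      (fun t t0 => (rP t t0).1) (fun t t0 => (rP t t0).2)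
      ((a + t%:C%C%:A) * u) t_gt0.
    have -> : star ((a + t%:C%C%:A) * u) * r t * ((a + t%:C%C%:A) * u) =
        star u * a * u + t%:C%C *: (star u * u).
      rewrite star_mulr starD a_star star_realZ1 -2!mulrA (mulrA (r t)) rl mul1r.
      by rewrite mulrDl mulrDr mulrA -scalerAl mul1r -scalerAr.
    rewrite linearD linearZ /=; case: (f _) => x1 x2; case: (f _) => y1 y2 /=.
    by rewrite mul0r subr0.
  have Reu_ge0 : 0 <= complex.Re (f (star u * u)).
    by have := f_pos u; rewrite lecE => /andP[].
  rewrite leNgt; apply/negP => Re_lt0.
  have b1 : 0 < complex.Re (f (star u * u)) + 1 by rewrite ltr_wpDl.
  set c := complex.Re _ in shifted Re_lt0; set b := complex.Re _ in shifted b1.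
  (* With this [t], [c + t * b <= c + t * (b + 1) = c / 2 < 0]. *)
  have t_gt0 : 0 < - c / (b + 1) / 2 by rewrite !divr_gt0 // oppr_gt0.
  have := shifted _ t_gt0.
  have : - c / (b + 1) * (b + 1) = - c by rewrite divfK // gt_eqF.
  nra.
rewrite lecE Re_ge0 andbT /=.
have := functional_conj f_pos u a_star; rewrite /weighted_form.
by case: (f _) => y1 y2 [] /eqP; rewrite eq_sym -addr_eq0 -mulr2n mulrn_eq0.
Qed.

(** * Real values of extended suprema *)

Section ExtendedSup.
Variable R : realType.

Lemma fine_ereal_sup_ge0 (S : set \bar R) :
  (forall y, S y -> (0 <= y)%E) -> 0 <= fine (ereal_sup S).
Proof.
move=> S_ge0; have [->|/set0P[y Sy]] := eqVneq S set0.
  by rewrite ereal_sup0.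
by apply: fine_ge0; apply: (le_trans (S_ge0 _ Sy)); exact: ereal_sup_ubound.
Qed.

(** The condition [0 <= m] serves the empty [S], whose supremum [-oo] is sent to 0 by [fine]. *)
Lemma fine_ereal_sup_le (S : set \bar R) (m : R) :
  0 <= m -> (forall y, S y -> (y <= m%:E)%E) -> fine (ereal_sup S) <= m.
Proof.
move=> m_ge0 S_le; have : (ereal_sup S <= m%:E)%E by apply/ge_ereal_sup.
by case: (ereal_sup S).
Qed.

(** The bound [m] excludes [+oo], which [fine] would send to 0. *)
Lemma le_fine_ereal_sup (S : set \bar R) (m y : R) :
  (forall z, S z -> (z <= m%:E)%E) -> S y%:E -> y <= fine (ereal_sup S).
Proof.
move=> S_le Sy; have : (ereal_sup S <= m%:E)%E by apply/ge_ereal_sup.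
have := ereal_sup_ubound Sy.
by case: (ereal_sup S) => //= r; rewrite lee_fin.
Qed.

End ExtendedSup.

Section RadiusNonneg.
Variables (R : realType) (A : cstarAlgType R) (a : A).

Lemma normc_complexE (z : R[i]) : `|z| = (Normc.normc z)%:C%C.
Proof. by case: z => z1 z2; rewrite normc_def. Qed.

Lemma normc_nonneg (z : R[i]) : 0 <= Normc.normc z.
Proof. by rewrite -ler0c -normc_complexE. Qed.

Lemma fine_num_radius_ge0 y : 0 <= fine (num_radius a y).
Proof.
by apply: fine_ereal_sup_ge0 => _ [f _ <-]; rewrite lee_fin normc_nonneg.
Qed.

Lemma fine_a_norm_ge0 y : 0 <= fine (a_norm a y).
Proof.
by apply: fine_ereal_sup_ge0 => _ [f _ <-]; rewrite lee_fin sqrtr_ge0.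
Qed.
End RadiusNonneg.

(** * Inequalities for a single state, then for the suprema *)

Section StateInequalities.
Variables (R : realType) (A : cstarAlgType R) (a : A).
Hypothesis a_pos : positive_element a.

Section State.
Variable f : {linear A -> R[i]^o}.
Hypothesis fS : a_states a f.
Let f_cont : continuous f. Proof. by case: fS. Qed.
Let f_pos : positive_functional f. Proof. by case: fS. Qed.
Let fa : f a = 1. Proof. by case: fS. Qed.
Local Notation W := (weighted_form f a).

Let W_ge0 u : 0 <= W u u.
Proof. exact: positive_element_form_ge0. Qed.

Let W11 : W 1 1 = 1.
Proof. by rewrite /weighted_form star1 mul1r mulr1. Qed.

Let W_CauchySchwarz u w : `|W u w| ^+ 2 <= W u u * W w w.
Proof.
exact: (psd_form_CauchySchwarz (weighted_form_linearl f a)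
  (weighted_form_linearr f a) W_ge0).
Qed.

Let W_Buzano u w : `|W u 1 * W 1 w| *+ 2 <= `|W u w| + (W u u + W w w) / 2.
Proof.
exact: (psd_form_Buzano (weighted_form_linearl f a)
  (weighted_form_linearr f a) W_ge0).
Qed.

(** Cauchy-Schwarz for the vectors [y] and 1, using [W 1 1 = 1]. *)
Lemma state_real_le_sqrt (y : A) : f (a * y) \is Num.real ->
  complex.Re (f (a * y)) <= Num.sqrt (complex.Re (f (star y * a * y))).
Proof.
move=> yreal; have := W_CauchySchwarz y 1; rewrite W11 mulr1.
rewrite {1}/weighted_form star1 mul1r real_normK // => le_sqr.
rewrite -[leRHS]ger0_norm ?sqrtr_ge0 //.
apply: (le_trans (ler_norm _)); rewrite -ler_sqr ?nnegrE //.
rewrite !real_normK ?num_real // sqr_sqrtr; last first.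
  by have := W_ge0 y; rewrite lecE => /andP[].
move: le_sqr; rewrite -(RRe_real yreal) -rmorphXn /= lecE => /andP[_].
by [].
Qed.

(* Iterating Cauchy-Schwarz gives [f (a y^2)^(2^k) <= f (a y^(2^(k+1)))], whose
   right-hand side grows at most like [|y|^(2^(k+1))]. *)
Lemma state_a_selfadjoint_bound (y : A) : a_adjoint a y y ->
  complex.Re (f (star y * a * y)) <= (rnorm y + 1) ^+ 2.
Proof.
move=> ay.
have starX n : star (y ^+ n) * a = a * y ^+ n.
  elim: n => [|n IH]; first by rewrite expr0 star1 mul1r mulr1.
  by rewrite exprSr star_mulr -mulrA IH mulrA -ay -mulrA -exprS exprSr mulrA.
have WX n m : W (y ^+ n) (y ^+ m) = f (a * y ^+ (m + n)).
  by rewrite /weighted_form starX -mulrA -exprD.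
(* Exponents start at 2, so that each value is [W v v] with [v = y ^ (2 ^ k)], hence real and
   nonnegative. *)
pose r k := complex.Re (f (a * y ^+ (2 ^ k.+1))).
have fE k : f (a * y ^+ (2 ^ k.+1)) = (r k)%:C%C.
  rewrite /r expnS mul2n -addnn -WX RRe_real //.
  exact: ger0_real.
have [K K_gt0 HK] := Re_functional_bound f_cont.
have -> : complex.Re (f (star y * a * y)) = r 0%N.
  by rewrite /r expn1 -ay -mulrA expr2.
have y1 : 0 < rnorm y + 1 by rewrite ltr_wpDl ?rnorm_ge0.
(* Here [m = (|y| + 1) ^ 2], so [m ^ (2 ^ k)] dominates the norm of [y ^ (2 ^ k.+1)]; the added 1
   makes [m] positive. *)
apply: (@doubly_exponential_bound _ r (K * rnorm a)).
- by rewrite exprn_gt0.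
- rewrite -ler0c -fE expn1 (_ : 2 = 1 + 1)%N // -WX; exact: W_ge0.
- move=> k; have := W_CauchySchwarz (y ^+ (2 ^ k.+1)) 1.
  rewrite W11 mulr1 -(expr0 y) !WX add0n addnn -mul2n -expnS !fE.
  rewrite real_normK; first by rewrite -rmorphXn lecR.
  by apply/complex_realP; exists (r k).
- move=> k; apply: (le_trans (ler_norm _)); apply: (le_trans (HK _)).
  rewrite -mulrA ler_wpM2l ?(ltW K_gt0) //; apply: (le_trans (rnormM _ _)).
  rewrite ler_wpM2l ?rnorm_ge0 // -exprM -expnS.
  have : (0 < 2 ^ k.+1)%N by rewrite expn_gt0.
  case: (2 ^ k.+1)%N => // n _; apply: (le_trans (rnormX _ _)).
  by rewrite lerXn2r ?nnegrE ?rnorm_ge0 ?(ltW y1) // lerDl.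
Qed.

Variables x xs : A.
Hypothesis adj : a_adjoint a x xs.
Let T := x * xs + xs * x.

(** Apply [star] to both sides, [a] being self-adjoint. *)
Lemma a_adjoint_sym : a_adjoint a xs x.
Proof.
rewrite /a_adjoint; have [a_star _] := a_pos.
by rewrite -[RHS]starK star_mulr starK a_star adj star_mulr a_star starK.
Qed.

(** Each of [x * xs] and [xs * x] is its own [a]-adjoint, by the two adjoint relations; the growth
    bound thus applies to [T]. *)
Lemma a_adjoint_anticommutator : a_adjoint a T T.
Proof.
rewrite /a_adjoint /T starD !star_mulr mulrDl -!mulrA.
rewrite -adj -a_adjoint_sym mulrDr !mulrA.
by rewrite a_adjoint_sym adj.
Qed.

Lemma state_anticommutatorE : f (a * T) = W x x + W xs xs.
Proof.
rewrite /weighted_form -linearD; congr (f _).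
by rewrite -adj -a_adjoint_sym -!mulrA -mulrDr addrC.
Qed.

Let faT_ge0 : 0 <= f (a * T).
Proof. by rewrite state_anticommutatorE addr_ge0. Qed.

Let f_squareE : f (a * x ^+ 2) = W x xs.
Proof. by rewrite /weighted_form -a_adjoint_sym expr2 mulrA. Qed.

Lemma state_anticommutator_le :
  complex.Re (f (a * T)) <= Num.sqrt (complex.Re (f (star T * a * T))).
Proof.
by apply: state_real_le_sqrt; exact: ger0_real.
Qed.

(** Cauchy-Schwarz for [W x xs] and [p q <= (p + q) ^ 2] suffice. This crude bound serves to keep
    [num_radius a (x ^+ 2)] from being [+oo]. *)
Lemma state_square_le :
  Normc.normc (f (a * x ^+ 2)) <= complex.Re (f (a * T)).
Proof.
rewrite -lecR -normc_complexE RRe_real ?ger0_real // state_anticommutatorE.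
rewrite f_squareE -ler_sqr ?nnegrE ?addr_ge0 //.
apply: (le_trans (W_CauchySchwarz _ _)); rewrite sqrrD -subr_ge0.
have -> : W x x ^+ 2 + W x x * W xs xs *+ 2 + W xs xs ^+ 2 - W x x * W xs xs =
  W x x ^+ 2 + W x x * W xs xs + W xs xs ^+ 2 by ring.
by rewrite !addr_ge0 ?exprn_ge0 ?mulr_ge0.
Qed.

(** Buzano's inequality at [x], [xs] and 1, where [W x 1] and [W 1 xs] both equal [f (a * x)]. *)
Lemma state_radius_le :
  Normc.normc (f (a * x)) ^+ 2 <= 1 / 2 * Normc.normc (f (a * x ^+ 2)) +
    1 / 2 * (complex.Re (f (a * T)) / 2).
Proof.
have Wx1 : W x 1 = f (a * x) by rewrite /weighted_form star1 mul1r.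
have W1xs : W 1 xs = f (a * x) by rewrite /weighted_form mulr1 -a_adjoint_sym.
have := W_Buzano x xs.
rewrite Wx1 W1xs -f_squareE -state_anticommutatorE normrM !normc_complexE.
rewrite -(RRe_real (ger0_real faT_ge0)) /=.
have -> : (2 : R[i]) = (2 : R)%:C%C by rewrite rmorph_nat.
rewrite -fmorphV -!rmorphM -rmorphMn -rmorphD lecR; lra.
Qed.
End State.

Variables x xs : A.
Hypothesis adj : a_adjoint a x xs.
Let T := x * xs + xs * x.

Lemma num_radius_sqr_le : fine (num_radius a x) ^+ 2 <=
  1 / 2 * fine (num_radius a (x ^+ 2)) + 1 / 2 * (fine (a_norm a T) / 2).
Proof.
have normT (f : {linear A -> R[i]^o}) : a_states a f ->
    Num.sqrt (complex.Re (f (star T * a * T))) <= rnorm T + 1.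
  move=> fS; rewrite -[leRHS]ger0_norm ?addr_ge0 ?rnorm_ge0 // -sqrtr_sqr.
  rewrite ler_wsqrtr // state_a_selfadjoint_bound //.
  exact: a_adjoint_anticommutator.
set rhs := leRHS.
have rhs_ge0 : 0 <= rhs.
  by rewrite addr_ge0 ?mulr_ge0 ?divr_ge0 ?fine_num_radius_ge0 ?fine_a_norm_ge0.
(* Taking square roots turns the claim into a bound on one supremum, checked state by state. *)
rewrite -[leRHS]sqr_sqrtr // ler_sqr ?nnegrE ?sqrtr_ge0 ?fine_num_radius_ge0 //.
apply: fine_ereal_sup_le => [|_ [f fS <-]]; first exact: sqrtr_ge0.
rewrite lee_fin -[leLHS]ger0_norm ?normc_nonneg // -sqrtr_sqr ler_wsqrtr //.
apply: (le_trans (state_radius_le fS adj)).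
have := state_anticommutator_le fS adj; rewrite -/T => aT.
(* The number [rnorm T + 1] bounds both suprema on the right, uniformly in the state. *)
apply: lerD; rewrite ler_wpM2l //.
  apply: (@le_fine_ereal_sup _ _ (rnorm T + 1)); last by exists f.
  move=> _ [g gS <-]; rewrite lee_fin.
  apply: (le_trans (state_square_le gS adj)).
  exact: (le_trans (state_anticommutator_le gS adj) (normT g gS)).
rewrite ler_wpM2r // (le_trans aT) //.
apply: (@le_fine_ereal_sup _ _ (rnorm T + 1)); last by exists f.
by move=> _ [g gS <-]; rewrite lee_fin normT.
Qed.
End StateInequalities.

(** * Midpoint convexity of the Orlicz function and conclusion *)

Lemma orlicz_midpoint_le (R : realType) (phi : R -> R) (u p q : R) :
  orlicz_function phi -> 0 <= u -> 0 <= p -> 0 <= q ->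
  u <= 1 / 2 * p + 1 / 2 * q -> phi u <= 1 / 2 * phi p + 1 / 2 * phi q.
Proof.
move=> [_ _ phi_convex phi_nd _] u0 p0 q0 upq.
have D (z : R) : 0 <= z -> [set` `[0%R, +oo[%R]%classic z.
  by move=> z0; rewrite /= in_itv /= z0.
apply: (le_trans (phi_nd _ _ (D _ u0) upq)).
have half0 : 0 <= 1 / 2 :> R by lra.
have half1 : 1 / 2 <= 1 :> R by lra.
have := @phi_convex (Itv01 half0 half1) p q (mem_set (D _ p0)) (mem_set (D _ q0)).
have half_onem : 1 - 1 / 2 = 1 / 2 :> R by lra.
have convE (y z : R^o) : conv (Itv01 half0 half1) y z = 1 / 2 * y + 1 / 2 * z.
  by rewrite convRE /= /unstable.onem half_onem.
by rewrite -(convE p q) -(convE (phi p) (phi q)).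
Qed.

Unset Implicit Arguments.

Theorem theorem2p16 (R : realType) (A : cstarAlgType R) (a x xs : A)
    (phi : R -> R) (a_neq0 : a != 0) (a_pos : positive_element a)
    (x_adj : a_adjointable a x) (xs_adj : a_adjoint a x xs)
    (phi_orlicz : orlicz_function phi) :
  phi (fine (num_radius a x) ^+ 2) <=
    1 / 2 * phi (fine (num_radius a (x ^+ 2))) +
    1 / 2 * phi (fine (a_norm a (x * xs + xs * x)) / 2).
Proof.
apply: orlicz_midpoint_le => //.
- exact: sqr_ge0.
- exact: fine_num_radius_ge0.
- by rewrite divr_ge0 // fine_a_norm_ge0.
- exact: num_radius_sqr_le.
Qed.
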